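(* Let $m_i$ be the mean absorption time (in any MFB) when starting in state $i\in\mathbb Z$. Then $$m_i=m_{i\bmod N}\qquad(i\in\mathbb Z).$$ Case $\rho\neq1$: if $0\le i\le N$, then $$m_i=\frac{N\rho^{-i}}{(q-p)(1-\rho^{-N})}+\frac{i}{q-p}+\frac{1}{s_0}+\frac{p_0+q_0(N-1)}{(q-p)s_0}+\frac{N[p_0\rho^{-1}+q_0\rho^{1-N}+r_0-1]}{(q-p)(1-\rho^{-N})s_0}.$$ Case $\rho=1$: if $0\le i\le N$, then $$m_i=\frac{i(N-i)}{2p}+\frac{1}{s_0}+\frac{(p_0+q_0)(N-1)}{2ps_0}.$$
   Context: Setting. Let $N>1$ be an integer. Consider a discrete-time random walk on $\mathbb Z$ with a multiple function barrier (MFB) at every point $kN$, $k\in\mathbb Z$. At each time step, a walker located at an MFB $kN$ moves to $kN+1$ with probability $p_0$, moves to $kN-1$ with probability $q_0$, stays in $kN$ with probability $r_0$, and is absorbed in that MFB (the walk ends) with probability $s_0$, where $p_0+q_0+r_0+s_0=1$, $r_0\ge 0$ and $p_0q_0s_0>0$. A walker located at a point that is not a multiple of $N$ moves one step forward ($+1$) with probability $p$, one step backward ($-1$) with probability $q$, and stays with probability $r=1-p-q\ge 0$, where $pq>0$. Here the walk may start in any $i\in\mathbb Z$. Notation. $\rho=p/q$. The absorption time is the number of time steps until absorption, where every step (moving, staying, and also the final step in which the walker is absorbed) counts as one unit of time. $i\bmod N$ is the representative of $i$ modulo $N$ in $\{0,\dots,N-1\}$. *)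

(* Defs.v *)
From HB Require Import structures.
From mathcomp Require Import all_boot all_order all_algebra.
From mathcomp Require Import all_classical all_reals all_analysis.
Set Implicit Arguments.
Unset Strict Implicit.
Unset Printing Implicit Defensive.
Import Order.TTheory GRing.Theory Num.Theory.
Local Open Scope classical_set_scope.
Local Open Scope ring_scope.

(* [inl x]: the walker is at x and the walk is still running;
   [inr x]: the walker has been absorbed in the barrier at x. *)
Definition state : Type := (int + int)%type.

(* The absorbed states are made permanent, so that the walk, which ends on
   absorption, becomes a process defined at all times. *)
Definition mfb_step (R : realType) (N : nat) (p0 q0 r0 s0 p q : R)
    (s t : state) : R :=
  match s, t with
  | inl x, inl y =>
      if (N%:Z %| x)%Z then
        if y == x + 1 then p0
        else if y == x - 1 then q0
        else if y == x then r0
        else 0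
      else
        if y == x + 1 then p
        else if y == x - 1 then q
        else if y == x then 1 - p - q
        else 0
  | inl x, inr y => if (N%:Z %| x)%Z && (y == x) then s0 else 0
  | inr _, inl _ => 0
  | inr x, inr y => if y == x then 1 else 0
  end.

(* The Markov property is multiplied out, so as not to divide by the
   probability of the history [X 0 = h 0, ..., X n = h n]. *)
Record markov_chain (d : measure_display) (T : measurableType d) (R : realType)
    (P : probability T R) (S : Type) (K : S -> S -> R) (x0 : S)
    (X : nat -> T -> S) : Prop := MarkovChain {
  markov_chain_measurable : forall n x, measurable (X n @^-1` [set x]) ;
  markov_chain_start : P (X 0%N @^-1` [set x0]) = 1%E ;
  markov_chain_step : forall (n : nat) (h : nat -> S),
    P [set w | forall k, (k <= n.+1)%N -> X k w = h k] =
    (P [set w | forall k, (k <= n)%N -> X k w = h k] * (K (h n) (h n.+1))%:E)%E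
}.

(* The infimum is [+oo] on a trajectory that is never absorbed. *)
Definition absorption_time (R : realType) (T : Type) (X : nat -> T -> state)
    (w : T) : \bar R :=
  ereal_inf [set n%:R%:E | n in [set n : nat | exists x : int, X n w = inr x]].

(* The library's ['E_P[_]] only takes real-valued functions. *)
Definition mean_absorption_time (d : measure_display) (T : measurableType d)
    (R : realType) (P : probability T R) (X : nat -> T -> state) : \bar R :=
  (\int[P]_w absorption_time R X w)%E.

(* Main.v *)
(* The mean absorption time is the sum over n of P(alive at time n).  Suppose f
   is nonnegative and bounded on Z, and f = 1 + K f there, where K is the kernel
   of the walk and f is set to 0 at absorbed states.  Then
     E[f(X_n); alive at n] = P(alive at n) + E[f(X_(n+1)); alive at n+1].
   Telescoping bounds the sum of the P(alive at n) by f(X_0); so P(alive at n)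
   tends to 0, E[f(X_n); alive at n] does too since f is bounded, and the sum is
   exactly f(X_0).  The closed formulas, extended N-periodically, satisfy
   f = 1 + K f, and f >= 0 follows from this equation at a minimum of f over a
   period. *)
Require Import Defs.
From HB Require Import structures.
From mathcomp Require Import all_boot all_order all_algebra.
From mathcomp Require Import all_classical all_reals all_analysis.
From mathcomp Require Import measurable_realfun ring lra zify.
Import Order.TTheory GRing.Theory Num.Theory.
Import numFieldNormedType.Exports.
Local Open Scope classical_set_scope.
Local Open Scope ring_scope.

Set Implicit Arguments.
Unset Strict Implicit.
Unset Printing Implicit Defensive.

(** * Sums over countable types *)

Section esum_countable.
Context {R : realType}.
Local Open Scope ereal_scope.

Lemma esum_exchange (S1 S2 : choiceType) (a : S1 -> S2 -> \bar R) :
  (forall i j, 0 <= a i j) ->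
  \esum_(i in [set: S1]) \esum_(j in [set: S2]) a i j =
  \esum_(j in [set: S2]) \esum_(i in [set: S1]) a i j.
Proof.
move=> a0; rewrite !esum_esum//.
rewrite (reindex_esum ([set: S2] `*` [set: S1]) _ (fun x => (x.2, x.1)))//.
split=> //=; first by move=> [i1 i2] [j1 j2] /= _ _ [] -> ->.
by move=> [i j] _ /=; exists (j, i).
Qed.

(** Numbers that encode no element of S contribute 0, so an unordered sum becomes a series, to which
    linearity of series and sigma-additivity apply. *)
Lemma esum_nneseries (S : countType) (a : S -> \bar R) :
  (forall x, 0 <= a x) ->
  \esum_(x in [set: S]) a x = \sum_(k <oo) oapp a 0 (@pickle_inv S k).
Proof.
move=> a0; rewrite nneseries_esumT; last by move=> k; case: pickle_inv => /=.
transitivity (\esum_(k in range (@pickle S)) oapp a 0 (@pickle_inv S k)).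
  rewrite esum_image; last by move=> x y _ _; exact: (pcan_inj pickleK).
  by apply: eq_esum => x _; rewrite pickleK_inv.
rewrite esum_mkcond; apply: eq_esum => k _; case: ifPn => //; apply: contraNeq.
case E: (@pickle_inv S k) => [x|]; last by rewrite eqxx.
by move=> _; rewrite inE; exists x => //; have := @pickle_invK S k; rewrite E.
Qed.

Lemma esumZl (S : countType) (a : S -> \bar R) (c : R) :
  (0 <= c)%R -> (forall x, 0 <= a x) ->
  \esum_(x in [set: S]) (c%:E * a x) = c%:E * \esum_(x in [set: S]) a x.
Proof.
move=> c0 a0; rewrite !esum_nneseries//; last first.
  by move=> x; rewrite mule_ge0.
rewrite -nneseriesZl; last by move=> k _; case: pickle_inv.
by apply: eq_eseriesr => k _; case: pickle_inv => //=; rewrite mule0.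
Qed.

(** The fibres of [Y] cut [B] into countably many disjoint measurable pieces: this is the law of
    total probability. *)
Lemma probability_preimage_esum d (T : measurableType d)
    (P : probability T R) (S : countType) (Y : T -> S) (B : set T) :
  (forall x, measurable (Y @^-1` [set x])) -> measurable B ->
  P B = \esum_(x in [set: S]) P (B `&` Y @^-1` [set x]).
Proof.
move=> mY mB; rewrite esum_nneseries//.
pose F k := oapp (fun x => B `&` Y @^-1` [set x]) set0 (@pickle_inv S k).
have BE : B = \bigcup_k F k.
  apply/seteqP; split=> [w Bw|w [k _]]; rewrite /F; last first.
    by case: pickle_inv => //= x [].
  by exists (pickle (Y w)) => //; rewrite pickleK_inv.
have mF k : measurable (F k).
  by rewrite /F; case: pickle_inv => //= x; exact: measurableI.
rewrite [X in P X = _]BE measure_semi_bigcup//; last exact: bigcupT_measurable.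
- apply: eq_eseriesr => k _; rewrite /F.
  by case: pickle_inv => [x|] /=; rewrite ?measure0.
- move=> i j _ _ [w []]; rewrite /F.
  have := @pickle_invK S i; have := @pickle_invK S j.
  case: pickle_inv => //= x <-; case: pickle_inv => //= y <-.
  by move=> [_ <-] [_ <-].
Qed.

End esum_countable.

(** * Transitions and expectations of a countable Markov chain *)

Section markov_chain.
Context d (T : measurableType d) (R : realType) (P : probability T R).
Context (S : countType) (K : S -> S -> R) (x0 : S) (X : nat -> T -> S).
Hypothesis K0 : forall x y, 0 <= K x y.
Hypothesis hX : markov_chain P K x0 X.
Local Open Scope ereal_scope.

Lemma measurable_chain n x : measurable (X n @^-1` [set x]).
Proof. exact: (markov_chain_measurable hX). Qed.

Lemma measurable_path (j n : nat) (h : nat -> S) :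
  measurable [set w | forall k, (j <= k <= n)%N -> X k w = h k].
Proof.
rewrite [X in measurable X](_ : _ = \bigcap_(k in [set k | (j <= k <= n)%N])
  (X k @^-1` [set h k])).
  by apply: bigcap_measurableType => k _; exact: measurable_chain.
by apply/seteqP; split=> w H k; exact: H.
Qed.

(* [markov_chain] gives the case j = 0; summing over the value of X_j forgets
   the oldest remaining coordinate of the history. *)
Lemma markov_chain_window (j n : nat) (h : nat -> S) : (j <= n)%N ->
  P [set w | forall k, (j <= k <= n.+1)%N -> X k w = h k] =
  (K (h n) (h n.+1))%:E * P [set w | forall k, (j <= k <= n)%N -> X k w = h k].
Proof.
elim: j h => [|j IH] h jn; first by rewrite muleC (markov_chain_step hX).
(* Only the value at time j is altered. As j < n, the kernel factor at times n and n+1 is the same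
   for every x and comes out of the sum. *)
pose h' x k := if k == j then x else h k.
have cons_path m : (j < m)%N ->
    P [set w | forall k, (j < k <= m)%N -> X k w = h k] =
    \esum_(x in [set: S])
      P [set w | forall k, (j <= k <= m)%N -> X k w = h' x k].
  move=> jm; have mj := measurable_path j.+1 m h.
  rewrite (probability_preimage_esum P (@measurable_chain j) mj).
  apply: eq_esum => x _; congr (P _).
  apply/seteqP; split=> [w [/= H Xj] k|w /= H].
    rewrite /h'; case: eqVneq => [->//|kj].
    by rewrite leq_eqVlt eq_sym (negbTE kj)/=; exact: H.
  split=> [k|]; last by rewrite /= H /h' ?eqxx// leqnn ltnW.
  move=> /andP[jk km]; have := H k; rewrite /h' (gtn_eqF jk); apply.
  by rewrite km ltnW.
rewrite !cons_path//; last exact: leqW.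
rewrite -esumZl//; apply: eq_esum => x _.
by rewrite IH ?(ltnW jn)// /h' (gtn_eqF jn) (gtn_eqF (leqW jn)).
Qed.

Lemma markov_chain_transition (n : nat) (x y : S) :
  P (X n @^-1` [set x] `&` X n.+1 @^-1` [set y]) =
  (K x y)%:E * P (X n @^-1` [set x]).
Proof.
(* The window shrinks to the single time n; the history need only be right at n and n+1. *)
have := @markov_chain_window n n (fun k => if k == n then x else y) (leqnn n).
rewrite eqxx gtn_eqF// => E; congr (P _ = _ * P _): E.
- apply/seteqP; split=> [w /= H|w [/= Xn Xn1] k].
    split; first by rewrite /= H ?eqxx// leqnn leqnSn.
    by rewrite /= H ?gtn_eqF// leqnSn leqnn.
  case: eqVneq => [->//|kn]; rewrite leq_eqVlt eq_sym (negbTE kn)/=.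
  by rewrite -eqn_leq => /eqP <-.
- apply/seteqP; split=> [w /= H|w /= Xn k]; first by rewrite H ?eqxx ?leqnn.
  by rewrite -eqn_leq => /eqP <-; rewrite eqxx.
Qed.

(** The expectation of phi(X_n), computed from the law of X_n; extended values spare any summability
    condition for nonnegative [phi]. *)
Definition expect (phi : S -> \bar R) (n : nat) : \bar R :=
  \esum_(x in [set: S]) (phi x * P (X n @^-1` [set x])).

Lemma expect_start (phi : S -> \bar R) : (forall x, 0 <= phi x) ->
  expect phi 0 = phi x0.
Proof.
move=> phi0; rewrite /expect.
(* The start has probability 1, so any other initial state lies in a null complement. *)
have X00 x : x != x0 -> P (X 0 @^-1` [set x]) = 0.
  move=> xx0; have /eqP := probability_setC P (measurable_chain 0 x0).
  rewrite (markov_chain_start hX) subee// => /eqP PC.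
  apply/eqP; rewrite -measure_le0 -PC le_measure ?inE//.
  - exact: measurable_chain.
  - exact: measurableC (measurable_chain _ _).
  - by move=> w /= ->; exact/eqP.
rewrite (_ : esum _ _ = \esum_(x in [set x0]) (phi x * P (X 0 @^-1` [set x]))).
  by rewrite esum_set1 ?mule_ge0// (markov_chain_start hX) mule1.
rewrite [RHS]esum_mkcond; apply: eq_esum => x _; case: ifPn => // /negP xx0.
by rewrite X00 ?mule0//; apply/eqP => xE; apply: xx0; rewrite inE.
Qed.

(** Splitting X_(n+1) = y over the values of X_n and exchanging the nonnegative sums moves the
    kernel from the law onto [phi]. *)
Lemma expect_step (phi : S -> R) n : (forall x, 0 <= phi x)%R ->
  expect (EFin \o phi) n.+1 =
  expect (fun x => \esum_(y in [set: S]) (K x y * phi y)%:E) n.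
Proof.
move=> phi0; rewrite /expect.
transitivity (\esum_(y in [set: S]) \esum_(x in [set: S])
    ((K x y * phi y)%:E * P (X n @^-1` [set x]))).
  apply: eq_esum => y _ /=; have mn := measurable_chain n.+1 y.
  rewrite (probability_preimage_esum P (measurable_chain n) mn) -esumZl//.
  apply: eq_esum => x _.
  by rewrite setIC markov_chain_transition muleA -EFinM mulrC.
rewrite esum_exchange; last by move=> x y; rewrite mule_ge0// lee_fin mulr_ge0.
apply: eq_esum => x _.
have /fineK <- : P (X n @^-1` [set x]) \is a fin_num.
  exact: fin_num_measure (measurable_chain _ _).
rewrite muleC -esumZl ?fine_ge0//; last by move=> y; rewrite lee_fin mulr_ge0.
by apply: eq_esum => y _; rewrite muleC.
Qed.

Lemma le_expect (phi psi : S -> \bar R) n :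
  (forall x, phi x <= psi x) -> expect phi n <= expect psi n.
Proof. by move=> le; apply: le_esum => x _; exact: lee_wpmul2r. Qed.

Lemma expect_ge0 (phi : S -> \bar R) n :
  (forall x, 0 <= phi x) -> 0 <= expect phi n.
Proof. by move=> phi0; apply: esum_ge0 => x _; exact: mule_ge0. Qed.

Lemma expectD (phi psi : S -> \bar R) n :
  (forall x, 0 <= phi x) -> (forall x, 0 <= psi x) ->
  expect (fun x => phi x + psi x) n = expect phi n + expect psi n.
Proof.
move=> phi0 psi0; rewrite /expect -esumD.
- by apply: eq_esum => x _; rewrite ge0_muleDl.
- by move=> x _; rewrite mule_ge0.
- by move=> x _; rewrite mule_ge0.
Qed.

Lemma expectZl (c : R) (phi : S -> \bar R) n :
  (0 <= c)%R -> (forall x, 0 <= phi x) ->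
  expect (fun x => c%:E * phi x) n = c%:E * expect phi n.
Proof.
move=> c0 phi0; rewrite /expect -esumZl//; last by move=> x; rewrite mule_ge0.
by apply: eq_esum => x _; rewrite muleA.
Qed.

End markov_chain.

(** * Telescoping and survival in a set of states *)

Lemma telescoping_series_cvg (R : realType) (a v : R^nat) (C : R) :
  (forall n, 0 <= a n) -> (forall n, 0 <= v n <= C * a n) ->
  (forall n, v n = a n + v n.+1) -> series a @ \oo --> v 0%N.
Proof.
move=> a0 vCa va.
have sumE n : series a n = v 0%N - v n.
  elim: n => [|n IH]; first by rewrite seriesEnat/= big_geq// subrr.
  by rewrite seriesSr IH (va n); ring.
(* Since v is nonnegative, the partial sums stay below v 0; the series converges and its terms
   vanish. *)
have a_cvg0 : a @ \oo --> (0 : R).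
  apply: cvg_series_cvg_0; apply: nondecreasing_is_cvgn.
    by apply/nondecreasing_series => n _ _; exact: a0.
  exists (v 0%N) => _ [n _ <-]; rewrite sumE gerBl.
  by have /andP[] := vCa n.
(* The domination by C * a turns the bound v 0 into the exact sum: no remainder survives in the
   limit. *)
have v_cvg0 : v @ \oo --> (0 : R).
  apply: (@squeeze_cvgr _ _ _ _ (fun=> 0) (fun n => C * a n)).
  - exact: nearW.
  - exact: cvg_cst.
  - by rewrite -[X in _ --> X](mulr0 C); apply: cvgMr.
have -> : series a = (fun n => v 0%N - v n) by apply/funext.
by rewrite -[X in _ --> X]subr0; apply: cvgB => //; exact: cvg_cst.
Qed.

(** The whole past is required to lie in [A], so that on each trajectory the number of n survived is
    the first time outside [A]. *)
Definition survives (T S : Type) (X : nat -> T -> S) (A : set S) (n : nat) :=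
  [set w | forall k, (k <= n)%N -> A (X k w)].

Section survival.
Context d (T : measurableType d) (R : realType) (P : probability T R).
Context (S : countType) (K : S -> S -> R) (x0 : S) (X : nat -> T -> S).
Hypothesis K0 : forall x y, 0 <= K x y.
Hypothesis hX : markov_chain P K x0 X.
Variable A : set S.
Local Open Scope ereal_scope.

Lemma measurable_chain_preimage n : measurable (X n @^-1` A).
Proof.
rewrite [X in measurable X](_ : _ =
    \bigcup_x (if x \in A then X n @^-1` [set x] else set0)).
  apply: countable_bigcupT_measurable; first exact: countableP.
  by move=> x; case: ifP => _ //; exact: (measurable_chain hX).
apply/seteqP; split=> [w Aw|w [x _]].
  by exists (X n w) => //; rewrite mem_set.
by case: ifPn => // /set_mem Ax /= XE; rewrite /= XE.
Qed.

Lemma probability_chain_preimage n :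
  P (X n @^-1` A) = expect P X (EFin \o \1_A) n.
Proof.
rewrite (probability_preimage_esum P (measurable_chain hX n)
  (measurable_chain_preimage n)).
apply: eq_esum => x _ /=; rewrite indicE.
case: (boolP (x \in A)) => [/set_mem|/negP] Ax.
  rewrite mul1e; congr (P _); apply/seteqP; split=> [w []//|w /= XE].
  by split=> //=; rewrite XE.
rewrite mul0e (_ : _ `&` _ = set0) ?measure0//.
by apply/seteqP; split=> // w [/= AX XE]; apply: Ax; rewrite -XE inE.
Qed.

(** The expectations v n of phi(X_n) satisfy v n = P(X_n in A) + v (n+1). The bound by C times the
    indicator makes [phi] vanish off [A] and gives v n <= C P(X_n in A), the domination that
    telescoping requires. *)
Lemma dynkin_formula (phi : S -> R) (C : R) : (0 <= C)%R ->
  (forall x, 0 <= phi x <= C * \1_A x)%R ->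
  (forall x, (phi x)%:E =
    (\1_A x)%:E + \esum_(y in [set: S]) (K x y * phi y)%:E) ->
  \sum_(n <oo) P (X n @^-1` A) = (phi x0)%:E.
Proof.
move=> C0 phiC phiE.
have phi0 x : (0 <= phi x)%R by have /andP[] := phiC x.
pose v n := expect P X (EFin \o phi) n.
have v0 n : 0 <= v n by apply: expect_ge0 => x; rewrite lee_fin.
have a_fin n : P (X n @^-1` A) \is a fin_num.
  exact: fin_num_measure (measurable_chain_preimage n).
have vC n : v n <= C%:E * P (X n @^-1` A).
  rewrite probability_chain_preimage -expectZl//; last first.
    by move=> x; rewrite lee_fin.
  by apply: le_expect => x /=; have /andP[] := phiC x.
(* Finiteness allows the telescoping to be carried out in R. *)
have v_fin n : v n \is a fin_num.
  rewrite ge0_fin_numE// (le_lt_trans (vC n))// -(fineK (a_fin n)) -EFinM.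
  exact: ltry.
have vS n : v n = P (X n @^-1` A) + v n.+1.
  rewrite probability_chain_preimage /v (expect_step K0 hX)// -expectD//.
  - by congr (expect P X _ n); apply/funext => x; exact: phiE.
  - by move=> x; rewrite lee_fin.
  - by move=> x; apply: esum_ge0 => y _; rewrite lee_fin mulr_ge0.
have sumE : (fun n => \sum_(0 <= k < n) P (X k @^-1` A)) =
    EFin \o series (fun n => fine (P (X n @^-1` A))).
  apply/funext => n; rewrite /= seriesEnat/= -sumEFin.
  by apply: eq_bigr => k _; rewrite fineK.
have := @telescoping_series_cvg R (fun k => fine (P (X k @^-1` A)))
  (fine \o v) C.
have -> : (fine \o v) 0%N = phi x0 by rewrite /= /v (expect_start hX).
move=> H.
apply/cvg_lim => //; rewrite sumE; apply: cvg_EFin; first exact: nearW.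
apply: H => n.
- exact: fine_ge0.
- by rewrite fine_ge0//= -lee_fin EFinM !fineK.
- by rewrite -fineD// -vS.
Qed.

Lemma survivesS n : survives X A n.+1 = survives X A n `&` X n.+1 @^-1` A.
Proof.
apply/seteqP; split=> [w H|w [H Aw] k].
  by split=> [k kn|]; apply: H; rewrite // leqW.
by rewrite leq_eqVlt => /predU1P[->//|]; exact: H.
Qed.

Lemma measurable_survives n : measurable (survives X A n).
Proof.
elim: n => [|n IH].
  rewrite (_ : survives X A 0 = X 0%N @^-1` A).
    exact: measurable_chain_preimage.
  by apply/seteqP; split=> [w|w Aw k]; [apply|rewrite leqn0 => /eqP ->].
by rewrite survivesS; apply: measurableI => //; exact: measurable_chain_preimage.
Qed.

Hypothesis A_no_entry : forall x y, ~ A x -> A y -> K x y = 0%R.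

(** The event splits over the countably many pairs (X_n, X_(n+1)): each pair has kernel value 0 or
    gives an empty event. *)
Lemma no_entry_null n : P (X n.+1 @^-1` A `\` X n @^-1` A) = 0.
Proof.
have mAA : measurable (X n.+1 @^-1` A `\` X n @^-1` A).
  by apply: measurableD; exact: measurable_chain_preimage.
rewrite (probability_preimage_esum P (measurable_chain hX n) mAA).
rewrite esum1// => x _.
have mx := measurableI _ _ mAA (measurable_chain hX n x).
rewrite (probability_preimage_esum P (measurable_chain hX n.+1) mx).
rewrite esum1// => y _.
have [[Ax Ay]|AN] := pselect (~ A x /\ A y).
  apply: (@subset_measure0 _ _ _ _ _
    (X n @^-1` [set x] `&` X n.+1 @^-1` [set y])).
  - by apply: measurableI => //; exact: (measurable_chain hX).
  - by apply: measurableI; exact: (measurable_chain hX).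
  - by move=> w [[_ ?] ?]; split.
  apply: (etrans (markov_chain_transition K0 hX n x y)).
  by rewrite A_no_entry ?mul0e.
rewrite (_ : _ `&` _ = set0) ?measure0//.
apply/seteqP; split=> // w [[[/= Ay Ax] xE] yE]; apply: AN.
by rewrite -xE -yE.
Qed.

(** A trajectory that is in [A] at time n after having left it must have re-entered [A], and each
    re-entry is a null event. *)
Lemma probability_survives n : P (survives X A n) = P (X n @^-1` A).
Proof.
suff H : P (X n @^-1` A `\` survives X A n) = 0.
  have mA := measurable_chain_preimage n; have mS := measurable_survives n.
  have -> : P (X n @^-1` A) = P (X n @^-1` A `\` survives X A n) +
    P (X n @^-1` A `&` survives X A n) := measureDI P mA mS.
  by rewrite H add0e setIidr// => w; apply.
elim: n => [|n IH].
  rewrite (_ : _ `\` _ = set0) ?measure0//.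
  apply/seteqP; split=> // w [Aw]; apply.
  by move=> k; rewrite leqn0 => /eqP ->.
have mA := measurable_chain_preimage; have mS := measurable_survives.
(* If X_n is in [A], survival had already failed by time n; otherwise the last step is a
   re-entry. *)
apply: (@subset_measure0 _ _ _ _ _
  ((X n @^-1` A `\` survives X A n) `|` (X n.+1 @^-1` A `\` X n @^-1` A))).
- exact: measurableD.
- by apply: measurableU; exact: measurableD.
- rewrite survivesS => w [AS NS]; have [An|An] := pselect (A (X n w)).
    by left; split=> // Sn; apply: NS.
  by right.
apply: null_set_setU; [exact: measurableD|exact: measurableD|exact: IH|].
exact: no_entry_null.
Qed.

End survival.

Lemma esum_support (R : realType) (S : choiceType) (a : S -> \bar R)
    (r : seq S) : uniq r -> (forall x, (0 <= a x)%E) ->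
  (forall x, x \notin r -> a x = 0%E) ->
  \esum_(x in [set: S]) a x = (\sum_(x <- r) a x)%E.
Proof.
move=> r_uniq a0 ar; rewrite fsbig_seq// -esum_fset//.
rewrite [RHS]esum_mkcond; apply: eq_esum => x _; case: ifPn => // /negP xr.
by rewrite ar//; apply/negP => xr'; apply: xr; rewrite inE.
Qed.

(** * The mean absorption time as a series of probabilities *)

Local Notation alive := (range (@inl int int)).

(** The indicator is 1 exactly for the n before the first absorption, and the number of such n is
    that time, possibly infinite. *)
Lemma absorption_timeE (R : realType) (T : Type) (X : nat -> T -> state) w :
  absorption_time R X w =
  (\sum_(n <oo) (\1_(survives X alive n) w)%:E)%E.
Proof.
have indic_alive n (b : bool) : reflect (survives X alive n w) b ->
    \1_(survives X alive n) w = b%:R :> R.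
  move=> sP; rewrite indicE; congr (_%:R); congr nat_of_bool.
  by apply/idP/idP => [/set_mem/sP//|/sP/mem_set].
have ind0 n : (0 <= (\1_(survives X alive n) w)%:E :> \bar R)%E.
  by rewrite lee_fin.
have [exn|nexn] := pselect (exists n, exists x, X n w = inr x).
  have exn' : exists n, `[< exists x, X n w = inr x >].
    by have [n Hn] := exn; exists n; exact/asboolP.
  have [n0 /asboolP n0P n0min] := ex_minnP exn'.
  have sE n : \1_(survives X alive n) w = (n < n0)%N%:R :> R.
    apply: indic_alive; apply: (iffP idP) => [nn0 k kn|sn].
      case E: (X k w) => [x|x]; first by exists x.
      have : (n0 <= k)%N by apply: n0min; apply/asboolP; exists x.
      by rewrite leqNgt (leq_ltn_trans kn nn0).
    rewrite ltnNge; apply/negP => n0n; have [x _] := sn _ n0n.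
    by have [y ->] := n0P.
  have -> : absorption_time R X w = n0%:R%:E.
    apply/eqP; rewrite eq_le; apply/andP; split.
      by apply: ereal_inf_lbound; exists n0.
    apply: le_ereal_inf_tmp => _ [n [x nx] <-]; rewrite lee_fin ler_nat.
    by apply: n0min; apply/asboolP; exists x.
  (* The terms equal to 1 are those with n = 0, ..., n0 - 1, so the absorbing step is counted; the
     tail is 0. *)
  rewrite (nneseries_split 0 n0)// add0n [X in (_ + X)%E]eseries0 ?adde0.
    rewrite (eq_big_nat _ _ (F2 := fun=> 1%E)); last first.
      by move=> k /andP[_ kn0]; rewrite sE kn0.
    by rewrite sumEFin big_const_nat subn0 -Monoid.iteropE.
  by move=> k nk _; rewrite sE ltnNge nk.
have sE n : \1_(survives X alive n) w = true%:R :> R.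
  apply: indic_alive; apply: (iffP idP) => // _ k _.
  case E: (X k w) => [x|x]; first by exists x.
  by exfalso; apply: nexn; exists k, x.
have -> : absorption_time R X w = +oo%E.
  rewrite /absorption_time (_ : [set _ | _ in _] = set0) ?ereal_inf0//.
  by apply/seteqP; split=> // ? [n [x nx] _]; apply: nexn; exists n, x.
(* Without absorption every indicator is 1, and k terms exceed A for k an Archimedean bound of A. *)
apply/esym/eqyP => A A0; pose k := Num.bound A.
apply: (@le_trans _ _ (\sum_(0 <= n < k) (\1_(survives X alive n) w)%:E)%E).
  rewrite sumEFin lee_fin (eq_bigr (fun=> 1)) => [|n _]; last exact: sE.
  by rewrite sumr_const_nat subn0; apply/ltW/archi_boundP/ltW.
exact: nneseries_lim_ge.
Qed.

(** Termwise integration gives the probabilities of survival up to n; absorbed states never lead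
    back, so these are the probabilities of being alive at n. *)
Lemma mean_absorption_timeE d (T : measurableType d) (R : realType)
    (P : probability T R) (K : state -> state -> R) (x0 : state)
    (X : nat -> T -> state) :
  (forall x y, 0 <= K x y) -> (forall x y, K (inr x) (inl y) = 0) ->
  markov_chain P K x0 X ->
  mean_absorption_time P X = (\sum_(n <oo) P (X n @^-1` alive))%E.
Proof.
move=> K0 Kabs hX; rewrite /mean_absorption_time.
under eq_integral do rewrite absorption_timeE.
have mS n : measurable (survives X alive n) by exact: (measurable_survives hX).
rewrite integral_nneseries//; last first.
  by move=> n; apply/measurable_EFinP; exact: measurable_indic.
apply: eq_eseriesr => n _; rewrite integral_indic// setIT.
apply: (probability_survives K0 hX) => -[x|x] y.
  by move=> xA; exfalso; apply: xA; exists x.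
by move=> _ [z _ <-].
Qed.

(** * The equation f = 1 + K f for the barrier walk *)

Section mean_absorption_time_mfb.
Context (R : realType) (N : nat) (p0 q0 r0 s0 p q : R).
Hypotheses (hp0 : 0 <= p0) (hq0 : 0 <= q0) (hr0 : 0 <= r0) (hs0 : 0 < s0).
Hypotheses (hp : 0 <= p) (hq : 0 <= q) (hr : 0 <= 1 - p - q).
Let K := mfb_step N p0 q0 r0 s0 p q.

Lemma mfb_step_ge0 x y : 0 <= K x y.
Proof.
by case: x => x; case: y => y; rewrite /K /=; do ?[case: ifP => _];
  rewrite // ltW.
Qed.

Lemma esum_mfb_step (f : int -> R) x : (forall x, 0 <= f x) ->
  (\esum_(y in [set: state])
    (K (inl x) y * (if y is inl z then f z else 0))%:E =
  (if (N%:Z %| x)%Z then p0 * f (x + 1) + q0 * f (x - 1) + r0 * f x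
   else p * f (x + 1) + q * f (x - 1) + (1 - p - q) * f x)%:E)%E.
Proof.
(* These are the only live targets; absorption carries the value 0, hence no term in s0. *)
move=> f0; pose r : seq (int + int) := [:: inl (x + 1); inl (x - 1); inl x].
have in_inl (y z : int) : (@inl int int y == inl z) = (y == z).
  by [].
rewrite (esum_support (r := r)).
- rewrite /r !big_cons big_nil adde0 -!EFinD /K /= !eqxx.
  have -> : (x - 1 == x + 1) = false by lia.
  have -> : (x == x + 1) = false by lia.
  have -> : (x == x - 1) = false by lia.
  by case: ifP => _; rewrite addrA.
- by rewrite /r/= !inE !in_inl; lia.
- by case=> y; rewrite lee_fin mulr_ge0// mfb_step_ge0.
- case=> y; last by rewrite mulr0.
  rewrite /r !inE !in_inl !negb_or /= => /and3P[/negPf-> /negPf-> /negPf->].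
  by case: ifP => _; rewrite mul0r.
Qed.

Lemma mean_absorption_time_solution (f : int -> R) (C : R)
    d (T : measurableType d) (P : probability T R) (X : nat -> T -> state) i :
  (forall x, 0 <= f x <= C) ->
  (forall x, (N%:Z %| x)%Z ->
    f x = 1 + (p0 * f (x + 1) + q0 * f (x - 1) + r0 * f x)) ->
  (forall x, ~~ (N%:Z %| x)%Z ->
    f x = 1 + (p * f (x + 1) + q * f (x - 1) + (1 - p - q) * f x)) ->
  markov_chain P K (inl i) X -> mean_absorption_time P X = (f i)%:E.
Proof.
move=> fC f_barrier f_interior hX.
have f0 x : 0 <= f x by have /andP[] := fC x.
rewrite (mean_absorption_timeE mfb_step_ge0 _ hX)//.
rewrite (dynkin_formula mfb_step_ge0 hX
  (phi := fun s => if s is inl x then f x else 0) (C := C))//.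
- by have /andP[/le_trans] := fC 0; apply.
- case=> x; rewrite indicE.
    by rewrite mem_set ?mulr1//; exists x.
  by rewrite memNset ?mulr0 ?lexx// => -[].
- case=> x; rewrite indicE.
    have xA : alive (inl x) by exists x.
    rewrite mem_set// (esum_mfb_step x f0).
    rewrite -EFinD; congr EFin.
    by case: ifPn => [/f_barrier|/f_interior].
  rewrite memNset ?esum1 ?adde0//; last by move=> -[].
  by case=> y _; rewrite /= ?mul0r ?mulr0.
Qed.

End mean_absorption_time_mfb.

(** * Periodic extension of a solution given on one period *)

Section periodic_solution.
Context (R : realType) (N : nat) (p0 q0 r0 s0 p q : R).
Hypothesis hN : (1 < N)%N.
Hypotheses (hp0 : 0 <= p0) (hq0 : 0 <= q0) (hr0 : 0 <= r0) (hs0 : 0 < s0).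
Hypothesis hsum0 : p0 + q0 + r0 + s0 = 1.
Hypotheses (hp : 0 <= p) (hq : 0 <= q) (hr : 0 <= 1 - p - q).
Variable g : int -> R.
Hypothesis g_periodic : g N = g 0.
(** The left neighbour -1 of the barrier 0 is represented by N - 1. *)
Hypothesis g_barrier : g 0 = 1 + (p0 * g 1 + q0 * g (N%:Z - 1) + r0 * g 0).
Hypothesis g_interior : forall j : int, 0 < j < N%:Z ->
  g j = 1 + (p * g (j + 1) + q * g (j - 1) + (1 - p - q) * g j).
Let f (x : int) := g (x %% N)%Z.

Let modN_bounds (x : int) : 0 <= (x %% N)%Z < N%:Z.
Proof. by rewrite modz_ge0 ?ltz_pmod//; lia. Qed.

(** At residue N - 1 the successor wraps around to 0, where [g_periodic] lets g N replace g 0. *)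
Let f_succ x : f (x + 1) = g ((x %% N)%Z + 1).
Proof.
rewrite /f -modzDml; have := modN_bounds x; move: (x %% N)%Z => r r_bounds.
have [rN|rN] := ltrP (r + 1) N%:Z; first by rewrite modz_small//; lia.
by have -> : r + 1 = N by [lia]; rewrite modzz g_periodic.
Qed.

Let f_pred x : (x %% N)%Z != 0 -> f (x - 1) = g ((x %% N)%Z - 1).
Proof.
rewrite /f -modzDml; have := modN_bounds x; move: (x %% N)%Z => r r_bounds r0'.
by rewrite modz_small//; lia.
Qed.

Let f_pred_barrier x : (x %% N)%Z = 0 -> f (x - 1) = g (N%:Z - 1).
Proof.
move=> xN; rewrite /f -modzDml xN -modzDl.
by rewrite modz_small//; lia.
Qed.

Let f_at_barrier x : (N%:Z %| x)%Z ->
  f x = 1 + (p0 * f (x + 1) + q0 * f (x - 1) + r0 * f x).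
Proof.
move=> /dvdz_mod0P xN; rewrite f_succ f_pred_barrier// /f xN add0r.
exact: g_barrier.
Qed.

Let f_in_interior x : ~~ (N%:Z %| x)%Z ->
  f x = 1 + (p * f (x + 1) + q * f (x - 1) + (1 - p - q) * f x).
Proof.
rewrite (sameP dvdz_mod0P eqP) => xN; rewrite f_succ f_pred// /f.
by apply: g_interior; have := modN_bounds x; lia.
Qed.

(** Extrema over a finite period are extrema over Z; [h] is the identity for minima and the opposite
    for maxima. *)
Let f_ord (h : R -> R) (k : 'I_N) :
  (forall j : 'I_N, h (g k) <= h (g j)) -> forall x, h (g k) <= h (f x).
Proof.
move=> hk x; have := modN_bounds x; rewrite /f.
by case: (x %% N)%Z => // j /andP[_ jN]; exact: (hk (Ordinal jN)).
Qed.

Let f_ge0 x : 0 <= f x.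
Proof.
pose i0 : 'I_N := Ordinal (ltnW hN).
case: (@arg_minP _ _ _ i0 xpredT (fun j : 'I_N => g j) isT) => k _ kmin.
have k_min y : g k <= f y by apply: (@f_ord id k) => j; exact: kmin.
apply: le_trans (k_min x).
have fk : f k = g k by rewrite /f modz_small//; have := ltn_ord k; lia.
have := k_min (k%:Z + 1); have := k_min (k%:Z - 1); rewrite -!(subr_ge0 (g k)).
have [/f_at_barrier|/f_in_interior] := boolP (N%:Z %| k%:Z)%Z; rewrite fk => gk.
  move=> /(mulr_ge0 hq0) pred_k /(mulr_ge0 hp0) succ_k.
  (* Bounding both neighbours below by the minimum g k leaves s0 * g k >= 1. *)
  have : 0 <= s0 * g k.
    have -> : s0 = 1 - p0 - q0 - r0 by move: hsum0 => sum_eq1; lra.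
    lra.
  by rewrite pmulr_rge0.
(* A minimum in the interior is contradictory: the equation would give 0 >= 1. *)
by move=> /(mulr_ge0 hq) pred_k /(mulr_ge0 hp) succ_k; lra.
Qed.

Lemma mean_absorption_time_periodic d (T : measurableType d)
    (P : probability T R) (X : nat -> T -> state) i :
  markov_chain P (mfb_step N p0 q0 r0 s0 p q) (inl i) X ->
  mean_absorption_time P X = (g (i %% N)%Z)%:E.
Proof.
move=> hX; pose i0 : 'I_N := Ordinal (ltnW hN).
(* The maximum of [g] over one period serves as the bound C. *)
case: (@arg_maxP _ _ _ i0 xpredT (fun j : 'I_N => g j) isT) => k _ kmax.
apply: (mean_absorption_time_solution hp0 hq0 hr0 hs0 hp hq hr (N := N)
  (f := f) (C := g k)) => // x.
rewrite f_ge0/= -lerN2; apply: (@f_ord -%R k) => j.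
by rewrite lerN2; exact: kmax.
Qed.

End periodic_solution.

(** * Verification of the closed formulas *)

Lemma interval_modz (A : Type) (g : int -> A) (N : nat) (i : int) :
  (0 < N)%N -> g N = g 0 -> 0 <= i <= N%:Z -> g (i %% N)%Z = g i.
Proof.
move=> N0 gN /andP[i0 iN]; have [iN'|iN'] := ltrP i N%:Z.
  by rewrite modz_small// i0.
have -> : i = N by apply/eqP; rewrite eq_le iN.
by rewrite modzz.
Qed.

Theorem theorem9 (R : realType) (N : nat) (p0 q0 r0 s0 p q : R)
  (hN : (1 < N)%N)
  (hp0 : 0 <= p0) (hq0 : 0 <= q0) (hr0 : 0 <= r0) (hs0 : 0 <= s0)
  (hsum0 : p0 + q0 + r0 + s0 = 1) (hpos0 : 0 < p0 * q0 * s0)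
  (hp : 0 <= p) (hq : 0 <= q) (hr : 0 <= 1 - p - q) (hpq : 0 < p * q)
  (d : int -> measure_display) (T : forall i, measurableType (d i))
  (P : forall i, probability (T i) R) (X : forall i, nat -> T i -> state)
  (hX : forall i, markov_chain (P i) (mfb_step N p0 q0 r0 s0 p q) (inl i) (X i)) :
  let rho := p / q in
  let m i := mean_absorption_time (P i) (X i) in
  [/\ forall i : int, m i = m (i %% N)%Z,
      rho != 1 -> forall i : int, 0 <= i <= N%:Z ->
        m i = (N%:R * rho ^ (- i) / ((q - p) * (1 - rho ^ (- N%:Z)))
               + i%:~R / (q - p)
               + 1 / s0
               + (p0 + q0 * (N%:R - 1)) / ((q - p) * s0)
               + N%:R * (p0 * rho^-1 + q0 * rho ^ (1 - N%:Z) + r0 - 1)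
                 / ((q - p) * (1 - rho ^ (- N%:Z)) * s0))%:E
    & rho = 1 -> forall i : int, 0 <= i <= N%:Z ->
        m i = (i%:~R * (N%:R - i%:~R) / (2 * p)
               + 1 / s0
               + (p0 + q0) * (N%:R - 1) / (2 * p * s0))%:E].
Proof.
move=> rho m.
have /andP[p_gt0 q_gt0] : (0 < p) && (0 < q).
  have := lt0r_neq0 hpq; rewrite mulf_eq0 negb_or.
  by rewrite !lt0r hp hq !andbT.
have s0_gt0 : 0 < s0.
  by rewrite lt0r hs0 andbT; apply: contraTneq hpos0 => ->; rewrite mulr0 ltxx.
have N_gt0 : (0 < N)%N := ltnW hN.
have p_neq0 : p != 0 by rewrite gt_eqF.
have q_neq0 : q != 0 by rewrite gt_eqF.
have s0_neq0 : s0 != 0 by rewrite gt_eqF.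
have r0E : r0 = 1 - p0 - q0 - s0 by lra.
(* Each case reduces to three algebraic identities for its formula: periodicity, the barrier
   equation and the interior equation. *)
have mE (g : int -> R) : g N = g 0 ->
    g 0 = 1 + (p0 * g 1 + q0 * g (N%:Z - 1) + r0 * g 0) ->
    (forall j : int, 0 < j < N%:Z ->
      g j = 1 + (p * g (j + 1) + q * g (j - 1) + (1 - p - q) * g j)) ->
    (forall i, m i = (g (i %% N)%Z)%:E) /\
    (forall i : int, 0 <= i <= N%:Z -> m i = (g i)%:E).
  move=> gN g_barrier g_interior.
  have mg i : m i = (g (i %% N)%Z)%:E.
    exact: (mean_absorption_time_periodic hN hp0 hq0 hr0 s0_gt0 hsum0 hp hq hr
      gN g_barrier g_interior (hX i)).
  by split=> // i iN; rewrite mg interval_modz.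
have rho_gt0 : 0 < rho by rewrite divr_gt0.
have rho_neq0 : rho != 0 by rewrite gt_eqF.
(* The interior equation has the particular solution i/(q-p) and the homogeneous solutions 1 and
   rho^(-i). Periodicity fixes the coefficient of rho^(-i), the barrier equation the constant. *)
pose g_biased (i : int) := N%:R * rho ^ (- i) / ((q - p) * (1 - rho ^ (- N%:Z)))
  + i%:~R / (q - p) + 1 / s0 + (p0 + q0 * (N%:R - 1)) / ((q - p) * s0)
  + N%:R * (p0 * rho^-1 + q0 * rho ^ (1 - N%:Z) + r0 - 1)
    / ((q - p) * (1 - rho ^ (- N%:Z)) * s0).
(* For p = q the particular solution is -i^2/(2p) and the homogeneous ones are 1 and i. *)
pose g_fair (i : int) := i%:~R * (N%:R - i%:~R) / (2 * p) + 1 / s0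
  + (p0 + q0) * (N%:R - 1) / (2 * p * s0).
have biased : rho != 1 -> (forall i, m i = (g_biased (i %% N)%Z)%:E) /\
    (forall i : int, 0 <= i <= N%:Z -> m i = (g_biased i)%:E).
  move=> rho_neq1.
  have qp_neq0 : q - p != 0.
    rewrite subr_eq0; apply: contra_neq rho_neq1 => qp.
    by rewrite /rho -qp divff.
  (* A positive rho with rho^N = 1 and N > 0 would be 1. *)
  have w_neq1 : 1 - rho ^ (- N%:Z) != 0.
    rewrite subr_eq0 eq_sym -exprnN invr_eq1.
    by rewrite pexpr_eq1 ?ltW.
  (* Shifts of the exponent become rational factors, so the remaining powers of rho can be
     generalized to variables for [field]. *)
  have rhoS j : rho ^ (- (j + 1)) = rho ^ (- j) * (q / p).
    by rewrite opprD expfzDr// exprN1 /rho invf_div.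
  have rhoP j : rho ^ (- (j - 1)) = rho ^ (- j) * (p / q).
    by rewrite opprB addrC expfzDr// expr1z.
  have rhoN : rho ^ (1 - N%:Z) = rho ^ (- N%:Z) * (p / q).
    by rewrite -rhoP opprB.
  have rhoV : rho^-1 = q / p by rewrite /rho invf_div.
  have NE : N%:~R = N%:R :> R by [].
  have rho0 : rho ^ (- 0) = 1 by [].
  apply: mE; rewrite /g_biased rhoN rhoV.
  (* With w = rho^(-N), this is w/(1-w) + 1 = 1/(1-w). *)
  - rewrite rho0 NE; move: (rho ^ (- N%:Z)) w_neq1 => w w_neq1.
    by field; do ?[apply/and5P; split].
  - rewrite !rho0 rhoP exprN1 rhoV intrB NE r0E.
    move: (rho ^ (- N%:Z)) w_neq1 => w w_neq1.
    by field; do ?[apply/and5P; split].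
  - move=> j _; rewrite rhoS rhoP intrB intrD.
    move: (rho ^ (- N%:Z)) (rho ^ (- j)) w_neq1 => w v w_neq1. 
    by field; do ?[apply/and5P; split].
have fair : rho = 1 -> (forall i, m i = (g_fair (i %% N)%Z)%:E) /\
    (forall i : int, 0 <= i <= N%:Z -> m i = (g_fair i)%:E).
  move=> rho1; have qE : q = p by rewrite -[p](mulfVK q_neq0) -/rho rho1 mul1r.
  apply: mE; rewrite /g_fair.
  - by rewrite subrr mulr0 !mul0r.
  - by rewrite intrB r0E; field; rewrite s0_neq0.
  - by move=> j _; rewrite intrB intrD qE; field; rewrite s0_neq0.
split=> [i|/biased[]//|/fair[]//].
have [/fair[mg _]|/eqP/biased[mg _]] := pselect (rho = 1).
  by rewrite !mg modz_mod.
by rewrite !mg modz_mod.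
Qed.
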